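(* Let $A \in \mathcal M_d(\mathbb R)$ and let $\tau$ be a delay function. Assume that $A \neq 0$ and that there exists an a.e. solution of $$x(t) = A x(t - \tau(t)), \qquad t \geq 0.$$ Then, with $\sigma_1\colon \mathbb R_+ \to \mathbb R$ given by $\sigma_1(t) = t - \tau(t)$, we have $\mathcal L(\sigma_1^{-1}(N)) = 0$ for every Lebesgue-measurable set $N \subset \mathbb R$ such that $\mathcal L(N) = 0$.
   Context: $\mathbb R_+ = [0, +\infty)$, $\mathbb R_+^\ast = (0, +\infty)$; $\mathcal M_d(\mathbb R)$ is the set of real $d \times d$ matrices, $d$ a positive integer; $\mathcal L$ is Lebesgue measure. For $a \leq b$ in $\mathbb R \cup \{\pm\infty\}$, $\lvert a, b)$ denotes $[a, b)$ if $a > -\infty$ and $(a, b)$ if $a = -\infty$. A \emph{delay function} is any function $\tau\colon \mathbb R_+ \to \mathbb R_+^\ast$. Its \emph{largest delay function} is $h\colon \mathbb R_+ \to \mathbb R_+^\ast \cup \{+\infty\}$, $h(t) = t - \inf_{s \in [t, +\infty)} (s - \tau(s))$. An \emph{almost everywhere (a.e.) solution} of the equation is a function $x\colon \lvert -h(0), +\infty) \to \mathbb R^d$ such that, for every function $\widetilde x\colon \lvert -h(0), +\infty) \to \mathbb R^d$ equal to $x$ almost everywhere, we have $\widetilde x(t) = A \widetilde x(t - \tau(t))$ for almost every $t \in \mathbb R_+$. (No measurability of $x$ is required.) *)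

(* Defs.v *)
From HB Require Import structures.
From mathcomp Require Import all_boot all_order all_algebra.
From mathcomp Require Import all_classical all_reals all_analysis.

Set Implicit Arguments.
Unset Strict Implicit.
Unset Printing Implicit Defensive.

Import Order.TTheory GRing.Theory Num.Theory.
Import numFieldNormedType.Exports.

Local Open Scope classical_set_scope.
Local Open Scope ring_scope.

(* R with the (complete) sigma-algebra of Lebesgue-measurable sets. The bare
   lebesgue_measure of the library lives on the Borel sets; here "Lebesgue
   measure" is its completion completed_lebesgue_measure. *)
Definition lebesgueType (R : realType) : measurableType _ :=
  caratheodory_type (wlength (@idfun R))^*%mu.

Definition lebesgue_measurable (R : realType) (N : set R) : Prop :=
  measurable (N : set (lebesgueType R)).

(* Functions on an interval I are represented by total functions on R whose
   values outside I are irrelevant: every notion below only looks at I. *)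

Definition delay_function (R : realType) (tau : R -> R) : Prop :=
  forall t : R, 0 <= t -> 0 < tau t.

Definition sigma1 (R : realType) (tau : R -> R) (t : R) : R := t - tau t.

Definition largest_delay (R : realType) (tau : R -> R) (t : R) : \bar R :=
  (t%:E - ereal_inf [set (s - tau s)%:E | s in `[t, +oo[])%E.

(* |a, b), which is [a, b) if a > -oo and (a, b) if a = -oo: as r ranges over
   the real numbers, the bound a <= r excludes nothing more when a = -oo. *)
Definition lbar_itv (R : realType) (a b : \bar R) : set R :=
  [set r : R | (a <= r%:E)%E /\ (r%:E < b)%E].

Definition solution_domain (R : realType) (tau : R -> R) : set R :=
  lbar_itv (- largest_delay tau 0)%E +oo%E.

Definition ae_solution (R : realType) (d : nat) (A : 'M[R]_d) (tau : R -> R)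
    (x : R -> 'cV[R]_d) : Prop :=
  forall y : R -> 'cV[R]_d,
    {ae @completed_lebesgue_measure R,
      forall t : R, solution_domain tau t -> y t = x t} ->
    {ae @completed_lebesgue_measure R,
      forall t : R, 0 <= t -> y t = A *m y (t - tau t)}.

(* Main.v *)
(** Changing a solution [x] by a vector [v] with [A v <> 0] on the null set [N]
    yields another function [y] equal to [x] almost everywhere. Since [x] and
    [y] both satisfy the equation almost everywhere, so does
    [A (y - x) (t - tau t) = 0], which fails whenever [t - tau t] is in [N].
    Measurability of the preimage comes from completeness of the measure. *)
Require Import Defs.
From HB Require Import structures.
From mathcomp Require Import all_boot all_order all_algebra.
From mathcomp Require Import all_classical all_reals all_analysis.

Import Order.TTheory GRing.Theory Num.Theory.
Import numFieldNormedType.Exports.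

Local Open Scope classical_set_scope.
Local Open Scope ring_scope.

(** A nonzero entry at [(i, j)] remains visible in column [j], the image of the [j]-th basis
    vector. *)
Lemma mulmx_col_neq0 (K : pzRingType) (m n : nat) (A : 'M[K]_(m, n)) :
  A != 0 -> exists v : 'cV[K]_n, A *m v != 0.
Proof.
move=> /matrix0Pn[i [j Aij]]; exists (delta_mx j 0).
by rewrite -colE; apply/cV0Pn; exists i; rewrite mxE.
Qed.

Theorem proposition4p24 (R : realType) (d : nat) (d_gt0 : (0 < d)%N)
    (A : 'M[R]_d) (tau : R -> R) (tau_delay : delay_function tau)
    (A_neq0 : A <> 0)
    (sol : exists x : R -> 'cV[R]_d, ae_solution A tau x) :
  forall N : set R,
    lebesgue_measurable N -> completed_lebesgue_measure N = 0%E ->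
    let preimN : set R := [set t : R | 0 <= t /\ N (sigma1 tau t)] in
    lebesgue_measurable preimN /\ completed_lebesgue_measure preimN = 0%E.
Proof.
move=> N mN N0 preimN.
have [x solx] := sol.
have [v /eqP Av] : exists v : 'cV[R]_d, A *m v != 0.
  by apply: mulmx_col_neq0; apply/eqP.
pose y t := if t \in N then x t + v else x t.
have ae_notN : {ae @completed_lebesgue_measure R, forall t, ~ N t}.
  by exists N; split => // t /= /contrapT.
have ae_filter := ae_filter_ringOfSetsType (@completed_lebesgue_measure R).
have yx t : ~ N t -> y t = x t by move=> Nt; rewrite /y memNset.
have ae_preimN : {ae @completed_lebesgue_measure R, forall t, ~ preimN t}.
  have eqy : {ae @completed_lebesgue_measure R,
      forall t : R, 0 <= t -> y t = A *m y (t - tau t)}.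
    by apply: solx; apply: filterS ae_notN => t /yx.
  (* [x] is itself an admissible modification of [x]. *)
  have eqx : {ae @completed_lebesgue_measure R,
      forall t : R, 0 <= t -> x t = A *m x (t - tau t)}.
    by apply: solx; apply: aeW.
  (* The point [t] must also avoid [N]: then [y t = x t], so the two right-hand sides agree,
     although they differ by [A *m v] when [t - tau t] is in [N]. *)
  apply: filterS3 ae_notN eqy eqx => t /yx -> eqyt eqxt [t0 Nst].
  apply: Av; move: (eqyt t0); rewrite (eqxt t0) /y mem_set // mulmxDr.
  by rewrite -[LHS]addr0 => /addrI.
have negl : (@completed_lebesgue_measure R).-negligible preimN.
  by apply: negligibleS ae_preimN => t /= + /(_ _).
have mpre : lebesgue_measurable preimN.
  exact: completed_lebesgue_measure_is_complete negl.
by split=> //; exact: measure_negligible.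
Qed.
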